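(* Let $G=(\mathcal V,\mathcal E)$ be a connected non-bipartite graph and consider the general stochastic matching model on $G$ with i.i.d. arrivals of law $\mu$ (with full support on $\mathcal V$) under the First Come, First Matched (FCFM) policy. Then the queue-detail Markov chain $(W_n)_{n\ge 0}$ is positive recurrent if and only if $\mu\in\textsc{Ncond}(G)$. In that case the unique stationary probability of $(W_n)$ is $$\Pi_W(w)=\alpha\prod_{\ell=1}^{q}\frac{\mu(w_\ell)}{\mu\big(\mathcal E(\{w_1,\dots,w_\ell\})\big)},\qquad w=w_1\cdots w_q\in\mathbb W$$ (with $\Pi_W(\emptyset)=\alpha$), where $\alpha>0$ is the normalizing constant making $\Pi_W$ a probability measure on $\mathbb W$.
   Context: $G=(\mathcal V,\mathcal E)$ is a finite connected simple graph, $\mathcal V=\{1,\dots,|\mathcal V|\}$; write $u - v$ if $\{u,v\}\in\mathcal E$. For $U\subset\mathcal V$, $\mathcal E(U)=\{v\in\mathcal V:\exists u\in U,\ u - v\}$. An independent set is a nonempty set of pairwise non-adjacent nodes; $\mathbb I(G)$ is the set of independent sets. $\textsc{Ncond}(G)$ is the set of probability measures $\mu$ on $\mathcal V$ with full support such that $\mu(\mathcal I)<\mu(\mathcal E(\mathcal I))$ for every $\mathcal I\in\mathbb I(G)$. Model: items arrive one at a time at times $n=1,2,\dots$; the classes $V_1,V_2,\dots$ are i.i.d. with law $\mu$. An arriving item of class $i$ is matched with an item present in the buffer whose class $j$ satisfies $i - j$, if there is one (and both items leave); otherwise it is stored in the buffer. Under FCFM the arriving item is matched with the oldest (earliest arrived)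 compatible item present. The queue detail $W_n\in\mathcal V^*$ is the word formed by the classes of the unmatched items present after the $n$-th arrival, in order of arrival, with $W_0=\emptyset$; it is a Markov chain with values in $\mathbb W=\{w\in\mathcal V^*:\ |w|_i|w|_j=0\ \text{for all } i - j\}$, where $|w|_i$ is the number of occurrences of letter $i$ in $w$. *)

(* Defs.v *)
From Stdlib Require Import Reals Lra List Arith Bool.
Import ListNotations.
Open Scope R_scope.

Definition vert (N : nat) : list nat := seq 1 N.
Definition inV (N v : nat) : Prop := (1 <= v <= N)%nat.

Definition sumR {A : Type} (l : list A) (f : A -> R) : R :=
  fold_right (fun a s => f a + s) 0 l.

Definition simple_graph (N : nat) (adj : nat -> nat -> bool) : Prop :=
  (forall u v, adj u v = adj v u) /\
  (forall u, adj u u = false) /\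
  (forall u v, adj u v = true -> inV N u /\ inV N v).

Fixpoint is_walk (adj : nat -> nat -> bool) (u : nat) (p : list nat) (v : nat) : Prop :=
  match p with
  | [] => u = v
  | x :: p' => adj u x = true /\ is_walk adj x p' v
  end.

Definition connected (N : nat) (adj : nat -> nat -> bool) : Prop :=
  forall u v, inV N u -> inV N v -> exists p, is_walk adj u p v.

Definition bipartite (N : nat) (adj : nat -> nat -> bool) : Prop :=
  exists c : nat -> bool, forall u v, adj u v = true -> c u <> c v.

Definition full_support_prob (N : nat) (mu : nat -> R) : Prop :=
  (forall v, inV N v -> 0 < mu v) /\ sumR (vert N) mu = 1.

Definition muS (N : nat) (mu : nat -> R) (A : nat -> bool) : R :=
  sumR (vert N) (fun v => if A v then mu v else 0).

Definition nbhd (adj : nat -> nat -> bool) (A : nat -> bool) (N : nat) : nat -> bool :=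
  fun v => existsb (fun u => A u && adj u v) (vert N).

Definition independent (N : nat) (adj : nat -> nat -> bool) (I : nat -> bool) : Prop :=
  (exists v, inV N v /\ I v = true) /\
  (forall v, I v = true -> inV N v) /\
  (forall u v, I u = true -> I v = true -> adj u v = false).

Definition Ncond (N : nat) (adj : nat -> nat -> bool) (mu : nat -> R) : Prop :=
  forall I, independent N adj I -> muS N mu I < muS N mu (nbhd adj I N).

Fixpoint fcfm (adj : nat -> nat -> bool) (w : list nat) (v : nat) : list nat :=
  match w with
  | [] => [v]
  | u :: w' => if adj v u then w' else u :: fcfm adj w' v
  end.

Definition inW (N : nat) (adj : nat -> nat -> bool) (w : list nat) : bool :=
  forallb (fun i => Nat.leb 1 i && Nat.leb i N) w &&
  forallb (fun i => forallb (fun j => negb (adj i j)) w) w.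

Fixpoint words (N k : nat) : list (list nat) :=
  match k with
  | O => [[]]
  | S k' => flat_map (fun w => map (fun v => v :: w) (vert N)) (words N k')
  end.

Definition weq (a b : list nat) : bool :=
  if list_eq_dec Nat.eq_dec a b then true else false.

Fixpoint first_ret (adj : nat -> nat -> bool) (w cur : list nat) (vs : list nat) : bool :=
  match vs with
  | [] => false
  | v :: vs' =>
      let c := fcfm adj cur v in
      match vs' with
      | [] => weq c w
      | _ => if weq c w then false else first_ret adj w c vs'
      end
  end.

Definition prodmu (mu : nat -> R) (vs : list nat) : R :=
  fold_right (fun v p => mu v * p) 1 vs.

Definition ret_prob (N : nat) (adj : nat -> nat -> bool) (mu : nat -> R)
  (w : list nat) (n : nat) : R :=
  sumR (words N n) (fun vs => if first_ret adj w w vs then prodmu mu vs else 0).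

Definition pos_recurrent_state (N : nat) (adj : nat -> nat -> bool) (mu : nat -> R)
  (w : list nat) : Prop :=
  Un_cv (sum_f_R0 (ret_prob N adj mu w)) 1 /\
  exists m, Un_cv (sum_f_R0 (fun n => INR n * ret_prob N adj mu w n)) m.

Definition pos_recurrent (N : nat) (adj : nat -> nat -> bool) (mu : nat -> R) : Prop :=
  forall w, inW N adj w = true -> pos_recurrent_state N adj mu w.

Definition trans (N : nat) (adj : nat -> nat -> bool) (mu : nat -> R)
  (w w' : list nat) : R :=
  sumR (vert N) (fun v => if weq (fcfm adj w v) w' then mu v else 0).

Definition sumW_partial (N : nat) (adj : nat -> nat -> bool) (f : list nat -> R)
  (n : nat) : R :=
  sum_f_R0 (fun k => sumR (words N k)
     (fun w => if inW N adj w then f w else 0)) n.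

Definition sumW (N : nat) (adj : nat -> nat -> bool) (f : list nat -> R) (l : R) : Prop :=
  Un_cv (sumW_partial N adj f) l.

Definition stationary (N : nat) (adj : nat -> nat -> bool) (mu : nat -> R)
  (pi : list nat -> R) : Prop :=
  (forall w, inW N adj w = true -> 0 <= pi w) /\
  sumW N adj pi 1 /\
  (forall w', inW N adj w' = true -> sumW N adj (fun w => pi w * trans N adj mu w w') (pi w')).

Fixpoint piU_aux (N : nat) (adj : nat -> nat -> bool) (mu : nat -> R)
  (pre rest : list nat) : R :=
  match rest with
  | [] => 1
  | u :: r =>
      mu u / muS N mu (nbhd adj (fun x => existsb (Nat.eqb x) (pre ++ [u])) N)
      * piU_aux N adj mu (pre ++ [u]) r
  end.

Definition piU (N : nat) (adj : nat -> nat -> bool) (mu : nat -> R) (w : list nat) : R :=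
  piU_aux N adj mu [] w.

(* Main.v *)
(** The measure [piU] is invariant because the words leading to [w] by a match are obtained by
inserting one letter [u] into [w], and the contributions of the insertion positions of a fixed
[u] telescope to [mu u * piU w]. Under [Ncond] it is summable: grouping the words by the order
of first appearance of their letters gives geometric series of ratios [mu(I) / mu(E(I)) < 1].
A probability that is invariant and positive makes every state positive recurrent, by Kac's
bound [pi w * E_w(return time) <= 1]. For uniqueness, the minimum of two invariant measures of
finite mass is invariant, which forces their ratio to be constant along prefixes. Conversely,
if [mu(E(I)) <= mu(I)], then [|w|_I - |w|_E(I)] is a submartingale vanishing at the empty
buffer, with positive drift at some one-letter state because [G] is not bipartite; so its
expectation on the event that the buffer has not emptied before time [n] stays bounded away
from [0], although it is at most [n * P(return time > n)], which tends to [0] under positive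
recurrence. *)

Require Import Defs.
From Stdlib Require Import Reals List Lra Lia Bool Arith Classical.
Import ListNotations.
Open Scope R_scope.

(** * Finite sums over lists *)

Section FiniteSums.
Context {A : Type}.
Implicit Types (l : list A) (f g : A -> R).

Lemma sumR_ext l f g : (forall x, In x l -> f x = g x) -> sumR l f = sumR l g.
Proof.
  induction l as [|a l IH]; simpl; intros H; [reflexivity|].
  rewrite H, IH by auto; reflexivity.
Qed.

Lemma sumR_plus l f g : sumR l (fun x => f x + g x) = sumR l f + sumR l g.
Proof. induction l; simpl; lra. Qed.

Lemma sumR_minus l f g : sumR l (fun x => f x - g x) = sumR l f - sumR l g.
Proof. induction l; simpl; lra. Qed.

Lemma sumR_scal c l f : sumR l (fun x => c * f x) = c * sumR l f.
Proof. induction l as [|a l IH]; simpl; [|rewrite IH]; ring. Qed.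

Lemma sumR_0 l f : (forall x, In x l -> f x = 0) -> sumR l f = 0.
Proof.
  induction l as [|a l IH]; simpl; intros H; [reflexivity|].
  rewrite H, IH by auto; ring.
Qed.

Lemma sumR_le l f g : (forall x, In x l -> f x <= g x) -> sumR l f <= sumR l g.
Proof.
  induction l as [|a l IH]; simpl; intros H; [lra|].
  apply Rplus_le_compat; auto.
Qed.

Lemma sumR_nonneg l f : (forall x, In x l -> 0 <= f x) -> 0 <= sumR l f.
Proof.
  intros H. rewrite <- (sumR_0 l (fun _ => 0)) by reflexivity. now apply sumR_le.
Qed.

Lemma sumR_app l l' f : sumR (l ++ l') f = sumR l f + sumR l' f.
Proof. induction l; simpl; lra. Qed.

Lemma sumR_ge_term l f a : (forall x, In x l -> 0 <= f x) -> In a l -> f a <= sumR l f.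
Proof.
  induction l as [|b l IH]; simpl; intros H [].
  - subst b. assert (0 <= sumR l f) by (apply sumR_nonneg; auto). lra.
  - assert (f a <= sumR l f) by auto. specialize (H b (or_introl eq_refl)). lra.
Qed.

Lemma sumR_eq0 l f a :
  (forall x, In x l -> 0 <= f x) -> sumR l f = 0 -> In a l -> f a = 0.
Proof.
  intros H E Ha. pose proof (sumR_ge_term l f a H Ha). specialize (H a Ha). lra.
Qed.

Lemma sumR_filter p l f :
  sumR (filter p l) f = sumR l (fun x => if p x then f x else 0).
Proof. induction l as [|a l IH]; simpl; [|destruct (p a); simpl; rewrite IH]; lra. Qed.

Lemma sumR_single l f a :
  NoDup l -> In a l -> (forall x, In x l -> x <> a -> f x = 0) -> sumR l f = f a.
Proof.
  induction l as [|b l IH]; simpl; intros Hd Ha H; [easy|].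
  inversion Hd as [|? ? Hb Hl]; subst.
  destruct Ha as [->|Ha].
  - rewrite sumR_0; [ring|]. intros x Hx. apply H; auto. intros ->; auto.
  - rewrite IH, H by (auto; intros ->; auto). ring.
Qed.
End FiniteSums.

Lemma sumR_map {A B} (h : A -> B) l f : sumR (map h l) f = sumR l (fun x => f (h x)).
Proof. induction l as [|a l IH]; simpl; [|rewrite IH]; reflexivity. Qed.

Lemma sumR_flat_map {A B} (h : A -> list B) l f :
  sumR (flat_map h l) f = sumR l (fun x => sumR (h x) f).
Proof. induction l as [|a l IH]; simpl; [|rewrite sumR_app, IH]; reflexivity. Qed.

Lemma sumR_swap {A B} (l : list A) (l' : list B) (f : A -> B -> R) :
  sumR l (fun x => sumR l' (f x)) = sumR l' (fun y => sumR l (fun x => f x y)).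
Proof.
  induction l as [|a l IH]; simpl.
  - symmetry; now apply sumR_0.
  - now rewrite IH, <- sumR_plus.
Qed.

Lemma NoDup_flat_map_disjoint {A B} (h : A -> list B) l :
  NoDup l -> (forall x, In x l -> NoDup (h x)) ->
  (forall x y b, In x l -> In y l -> In b (h x) -> In b (h y) -> x = y) ->
  NoDup (flat_map h l).
Proof.
  induction l as [|a l IH]; simpl; intros Hd Hn Hx; [constructor|].
  inversion Hd as [|? ? Ha Hl]; subst.
  apply NoDup_app; auto.
  - apply IH; auto. intros x y b ? ?; apply Hx; auto.
  - intros b Hb Hb'. apply in_flat_map in Hb' as (y & Hy & Hb').
    rewrite (Hx a y b) in Ha by auto. auto.
Qed.

Lemma sum_f_R0_last (F : nat -> R) p :
  (forall k, (k < p)%nat -> F k = 0) -> sum_f_R0 F p = F p.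
Proof.
  destruct p as [|p]; intros H; [reflexivity|]. simpl.
  rewrite sum_eq_R0; [ring|]. intros k Hk. apply H. lia.
Qed.

(** * Words over the vertex set *)

Lemma weq_spec a b : weq a b = true <-> a = b.
Proof. unfold weq. destruct list_eq_dec; split; congruence. Qed.

Lemma weq_reflect a b : reflect (a = b) (weq a b).
Proof. unfold weq. destruct list_eq_dec; now constructor. Qed.

Lemma in_vert N v : In v (vert N) <-> inV N v.
Proof. unfold vert, inV. rewrite in_seq. lia. Qed.

Lemma in_words N k w : In w (words N k) <-> length w = k /\ Forall (inV N) w.
Proof.
  revert w; induction k as [|k IH]; intros w; simpl.
  - split; [intros [<-|[]]; auto|]. intros [H _]. destruct w; [auto|discriminate].
  - rewrite in_flat_map. split.
    + intros (t & Ht & Hw). apply in_map_iff in Hw as (v & <- & Hv).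
      apply IH in Ht as [<- Ht]. apply in_vert in Hv. auto.
    + intros [Hl Hw]. destruct w as [|v t]; [discriminate|].
      inversion Hw; subst. exists t. split; [apply IH; auto|].
      apply in_map_iff. exists v. split; auto. now apply in_vert.
Qed.

Lemma NoDup_vert N : NoDup (vert N).
Proof. apply seq_NoDup. Qed.

Lemma NoDup_words N k : NoDup (words N k).
Proof.
  induction k as [|k IH]; simpl; [repeat constructor; auto|].
  apply NoDup_flat_map_disjoint; auto.
  - intros t _. apply NoDup_map_NoDup_ForallPairs; [|apply NoDup_vert].
    intros u v _ _ E. now inversion E.
  - intros t t' b _ _ H H'. apply in_map_iff in H as (? & <- & _).
    apply in_map_iff in H' as (? & E & _). now inversion E.
Qed.

Lemma sumR_words_S N k f :
  sumR (words N (S k)) f = sumR (words N k) (fun t => sumR (vert N) (fun v => f (v :: t))).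
Proof. simpl. rewrite sumR_flat_map. apply sumR_ext. intros t _. apply sumR_map. Qed.

(** * The FCFM dynamics *)

Section Buffer.
Variables (N : nat) (adj : nat -> nat -> bool).
Hypothesis Hg : simple_graph N adj.

Let adjC u v : adj u v = adj v u.
Proof. apply Hg. Qed.

Definition hit (w : list nat) (v : nat) : bool := existsb (fun a => adj a v) w.

Lemma hit_true w v : hit w v = true <-> exists a, In a w /\ adj a v = true.
Proof. apply existsb_exists. Qed.

Lemma hit_false w v : hit w v = false <-> forall a, In a w -> adj a v = false.
Proof.
  split.
  - intros H a Ha. destruct (adj a v) eqn:E; [|reflexivity].
    rewrite <- H. symmetry. apply hit_true. eauto.
  - intros H. destruct (hit w v) eqn:E; [|reflexivity].
    apply hit_true in E as (a & Ha & E). now rewrite H in E.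
Qed.

Lemma hit_incl w w' v : incl w w' -> hit w v = true -> hit w' v = true.
Proof. rewrite !hit_true. intros H (a & Ha & E). eauto. Qed.

Lemma hit_equiv w w' v : (forall x, In x w <-> In x w') -> hit w v = hit w' v.
Proof.
  intros H. apply eq_true_iff_eq. split; apply hit_incl; intros x; apply H.
Qed.

Lemma hit_app w w' v : hit (w ++ w') v = hit w v || hit w' v.
Proof. apply existsb_app. Qed.

Lemma hit_snoc w u v : hit (w ++ [u]) v = hit w v || adj u v.
Proof. rewrite hit_app. simpl. now rewrite orb_false_r. Qed.

Lemma inW_spec w :
  inW N adj w = true <->
  (forall i, In i w -> inV N i) /\ (forall i j, In i w -> In j w -> adj i j = false).
Proof.
  unfold inW. rewrite andb_true_iff, !forallb_forall.
  split; intros [H1 H2]; split.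
  - intros i Hi. specialize (H1 i Hi). apply andb_true_iff in H1 as [a b].
    apply Nat.leb_le in a, b. now split.
  - intros i j Hi Hj. specialize (H2 i Hi). rewrite forallb_forall in H2.
    now apply negb_true_iff, H2.
  - intros i Hi. apply andb_true_iff. rewrite !Nat.leb_le. now apply H1.
  - intros i Hi. apply forallb_forall. intros j Hj. now apply negb_true_iff, H2.
Qed.

Lemma inW_incl w w' : incl w w' -> inW N adj w' = true -> inW N adj w = true.
Proof. rewrite !inW_spec. intros H [H1 H2]. split; auto. Qed.

Lemma inW_equiv w w' : (forall x, In x w <-> In x w') -> inW N adj w = inW N adj w'.
Proof.
  intros H. apply eq_true_iff_eq. split; apply inW_incl; intros x; apply H.
Qed.

Lemma inW_cons u w : inV N u ->
  inW N adj (u :: w) = (inW N adj w && negb (hit w u))%bool.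
Proof.
  intros Hu. apply eq_true_iff_eq.
  rewrite andb_true_iff, negb_true_iff, hit_false, !inW_spec. simpl. split.
  - intros [H1 H2]. split; [split|]; auto.
  - intros [[H1 H2] H3]. split.
    + intros i [<-|Hi]; auto.
    + intros i j [<-|Hi] [<-|Hj]; auto.
      * apply Hg.
      * rewrite adjC. auto.
Qed.

Lemma inW_snoc w v :
  inV N v -> inW N adj w = true -> hit w v = false -> inW N adj (w ++ [v]) = true.
Proof.
  intros Hv Hw Hh. rewrite (inW_equiv _ (v :: w)), inW_cons, Hw, Hh; auto.
  intros x. rewrite in_app_iff. simpl. tauto.
Qed.

Lemma inW_words w : inW N adj w = true -> In w (words N (length w)).
Proof.
  intros H. apply in_words. split; [reflexivity|]. apply Forall_forall.
  now apply inW_spec in H.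
Qed.

(** The order of service is deliberately forgotten: that [u] is the oldest compatible letter is not
    recorded. It matters for the invariance of the product form, where the recursion of [fcfm]
    itself is followed. *)
Lemma fcfm_cases w v :
  (hit w v = false /\ fcfm adj w v = w ++ [v]) \/
  (exists a u b, w = a ++ u :: b /\ adj v u = true /\ fcfm adj w v = a ++ b).
Proof.
  induction w as [|x w IH]; simpl; [now left|].
  destruct (adj v x) eqn:E.
  - right. exists [], x, w. auto.
  - rewrite (adjC x v), E. destruct IH as [[H1 H2]|(a & u & b & -> & Hu & ->)].
    + left. rewrite H2. auto.
    + right. exists (x :: a), u, b. auto.
Qed.

Lemma fcfm_no_hit w v : hit w v = false -> fcfm adj w v = w ++ [v].
Proof.
  intros H. destruct (fcfm_cases w v) as [[_ E]|(a & u & b & -> & Hu & _)]; [exact E|].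
  rewrite hit_false in H. rewrite adjC, H in Hu by (apply in_elt). discriminate.
Qed.

Lemma fcfm_length w v :
  length (fcfm adj w v) = S (length w) \/ length w = S (length (fcfm adj w v)).
Proof.
  destruct (fcfm_cases w v) as [[_ ->]|(a & u & b & -> & _ & ->)];
    rewrite !length_app; simpl; lia.
Qed.

Lemma fcfm_inW w v : inV N v -> inW N adj w = true -> inW N adj (fcfm adj w v) = true.
Proof.
  intros Hv Hw. destruct (fcfm_cases w v) as [[H ->]|(a & u & b & -> & _ & ->)].
  - now apply inW_snoc.
  - revert Hw. apply inW_incl. intros x. rewrite !in_app_iff. simpl. tauto.
Qed.

(** Finite exhaustion of the state space. Series over admissible words become limits of sums over
    these duplicate-free lists, in which the order of summation can be exchanged freely. *)
Definition states (n : nat) : list (list nat) :=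
  filter (inW N adj) (flat_map (words N) (seq 0 (S n))).

Lemma in_states n w : In w (states n) <-> inW N adj w = true /\ (length w <= n)%nat.
Proof.
  unfold states. rewrite filter_In, in_flat_map. split.
  - intros [(k & Hk & Hw) H]. split; auto. apply in_words in Hw as [<- _].
    apply in_seq in Hk. lia.
  - intros [H L]. split; auto. exists (length w). split; [|now apply inW_words].
    apply in_seq. lia.
Qed.

Lemma NoDup_states n : NoDup (states n).
Proof.
  apply NoDup_filter, NoDup_flat_map_disjoint.
  - apply seq_NoDup.
  - intros; apply NoDup_words.
  - intros x y b _ _. rewrite !in_words. intros [<- _] [<- _]. reflexivity.
Qed.

Lemma states_S n : states (S n) = states n ++ filter (inW N adj) (words N (S n)).
Proof.
  unfold states. rewrite seq_S, flat_map_app, filter_app. simpl (flat_map _ [_]).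
  now rewrite app_nil_r.
Qed.

Lemma sumW_partial_states f n : sumW_partial N adj f n = sumR (states n) f.
Proof.
  induction n as [|n IH].
  - unfold sumW_partial, states. simpl. destruct (inW N adj []); simpl; lra.
  - rewrite states_S, sumR_app, <- IH, sumR_filter. reflexivity.
Qed.

Lemma sumR_states_le f n m :
  (n <= m)%nat -> (forall w, inW N adj w = true -> 0 <= f w) ->
  sumR (states n) f <= sumR (states m) f.
Proof.
  intros Hnm Hf. induction Hnm as [|m Hnm IH]; [lra|].
  rewrite states_S, sumR_app.
  assert (0 <= sumR (filter (inW N adj) (words N (S m))) f); [|lra].
  apply sumR_nonneg. intros x Hx. apply filter_In in Hx as [_ Hx]. auto.
Qed.

Lemma sumR_states_eq f n m :
  (n <= m)%nat ->
  (forall w, inW N adj w = true -> (n < length w)%nat -> f w = 0) ->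
  sumR (states m) f = sumR (states n) f.
Proof.
  intros Hnm Hf. induction Hnm as [|m Hnm IH]; [reflexivity|].
  rewrite states_S, sumR_app, IH, (sumR_0 (filter _ _)); [ring|].
  intros x Hx. apply filter_In in Hx as [Hx HW]. apply in_words in Hx as [Hx _].
  apply Hf; auto. lia.
Qed.

(** * The transition kernel and its action on functions *)

Variable mu : nat -> R.
Hypothesis Hmu : full_support_prob N mu.

Lemma mu_pos v : inV N v -> 0 < mu v.
Proof. apply Hmu. Qed.

Lemma mu_vert v : In v (vert N) -> 0 < mu v.
Proof. intros H. now apply mu_pos, in_vert. Qed.

Lemma sum_mu : sumR (vert N) mu = 1.
Proof. apply Hmu. Qed.

Lemma trans_nonneg w w' : 0 <= trans N adj mu w w'.
Proof.
  apply sumR_nonneg. intros v Hv. apply mu_vert in Hv. destruct weq; lra.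
Qed.

Lemma trans_far w w' :
  length w <> S (length w') -> S (length w) <> length w' -> trans N adj mu w w' = 0.
Proof.
  intros H1 H2. apply sumR_0. intros v _. destruct (weq_reflect (fcfm adj w v) w'); auto.
  subst w'. destruct (fcfm_length w v); lia.
Qed.

(** The only form of irreducibility that uniqueness needs: a state is reached in one step from its
    longest proper prefix. *)
Lemma trans_snoc_pos w v : inW N adj (w ++ [v]) = true -> 0 < trans N adj mu w (w ++ [v]).
Proof.
  intros H. apply inW_spec in H as [H1 H2].
  assert (Hv : inV N v) by (apply H1, in_elt).
  apply Rlt_le_trans with (mu v); [now apply mu_pos|].
  replace (mu v) with (if weq (fcfm adj w v) (w ++ [v]) then mu v else 0).
  - apply (sumR_ge_term _ (fun x => if weq (fcfm adj w x) (w ++ [v]) then mu x else 0));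
      [|now apply in_vert].
    intros x Hx. apply mu_vert in Hx. destruct weq; lra.
  - rewrite fcfm_no_hit; [now rewrite (proj2 (weq_spec _ _))|].
    apply hit_false. intros a Ha. apply H2; apply in_app_iff; simpl; auto.
Qed.

Definition step (h : list nat -> R) (w : list nat) : R :=
  sumR (vert N) (fun v => mu v * h (fcfm adj w v)).

Lemma step_le h h' w :
  (forall v, inV N v -> h (fcfm adj w v) <= h' (fcfm adj w v)) -> step h w <= step h' w.
Proof.
  intros H. apply sumR_le. intros v Hv. apply Rmult_le_compat_l.
  - now apply Rlt_le, mu_vert.
  - now apply H, in_vert.
Qed.

Lemma step_const c w : step (fun _ => c) w = c.
Proof.
  unfold step. rewrite (sumR_ext _ _ (fun v => c * mu v)) by (intros; ring).
  rewrite sumR_scal, sum_mu. ring.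
Qed.

(** Links the kernel indexed by target states with the average over arrivals. An arrival lengthens
    the word by at most one letter, so [states (S n)] contains every target. *)
Lemma sum_trans h n w : In w (states n) ->
  sumR (states (S n)) (fun x => trans N adj mu w x * h x) = step h w.
Proof.
  intros Hw. apply in_states in Hw as [Hw Hl].
  transitivity (sumR (states (S n)) (fun x => sumR (vert N)
    (fun v => if weq (fcfm adj w v) x then mu v * h x else 0))).
  { apply sumR_ext. intros x _. unfold trans. rewrite Rmult_comm, <- sumR_scal.
    apply sumR_ext. intros v _. destruct weq; ring. }
  rewrite sumR_swap. apply sumR_ext. intros v Hv. apply in_vert in Hv.
  rewrite (sumR_single _ _ (fcfm adj w v)).
  - now rewrite (proj2 (weq_spec _ _)).
  - apply NoDup_states.
  - apply in_states. split; [now apply fcfm_inW|]. destruct (fcfm_length w v); lia.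
  - intros x _ Hx. destruct (weq_reflect (fcfm adj w v) x); congruence.
Qed.

(** * Invariant measures *)

Definition balanced (p : list nat -> R) : Prop :=
  forall n x, In x (states n) ->
    sumR (states (S n)) (fun w => p w * trans N adj mu w x) = p x.

Definition nonnegW (p : list nat -> R) : Prop := forall w, inW N adj w = true -> 0 <= p w.

Lemma sum_trans_stable p x m : (S (length x) <= m)%nat ->
  sumR (states m) (fun w => p w * trans N adj mu w x) =
  sumR (states (S (length x))) (fun w => p w * trans N adj mu w x).
Proof.
  intros Hm. apply sumR_states_eq; auto.
  intros w _ Hw. rewrite trans_far by lia. ring.
Qed.

(* A transition changes the length by one, so each balance equation is a finite sum. *)
Lemma stationary_balanced p :
  stationary N adj mu p <->
  nonnegW p /\ Un_cv (fun n => sumR (states n) p) 1 /\ balanced p.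
Proof.
  unfold stationary, sumW. apply and_iff_compat_l.
  assert (Hcv : forall f l, Un_cv (sumW_partial N adj f) l <->
                            Un_cv (fun n => sumR (states n) f) l).
  { intros f l. unfold Un_cv. setoid_rewrite sumW_partial_states. reflexivity. }
  rewrite Hcv. apply and_iff_compat_l.
  setoid_rewrite Hcv. split.
  - intros H n x Hx. pose proof Hx as Hx'. apply in_states in Hx' as [HW Hl].
    rewrite (sum_trans_stable p x) by lia.
    apply (UL_sequence (fun n => sumR (states n) (fun w => p w * trans N adj mu w x))); auto.
    intros eps He. exists (S (length x)). intros m Hm.
    rewrite (sum_trans_stable p x) by lia.
    unfold Rdist. rewrite Rminus_diag, Rabs_R0. lra.
  - intros H x Hx eps He. exists (S (length x)). intros m Hm.
    assert (Hs : In x (states (length x))) by (apply in_states; auto).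
    rewrite (sum_trans_stable p x) by lia. rewrite H by exact Hs.
    unfold Rdist. rewrite Rminus_diag, Rabs_R0. lra.
Qed.

(** A truncated form of the invariance of the integral of [h]. Only an inequality survives, since
    the right side also counts transitions into [states (S n)] from words longer than [n]. *)
Lemma balanced_step_le p h n : nonnegW p -> balanced p -> nonnegW h ->
  sumR (states n) (fun w => p w * step h w) <= sumR (states (S n)) (fun w => p w * h w).
Proof.
  intros Hp Hb Hh.
  transitivity (sumR (states (S n)) (fun x =>
    sumR (states n) (fun w => p w * trans N adj mu w x * h x))).
  - apply Req_le. rewrite <- sumR_swap. apply sumR_ext. intros w Hw.
    rewrite <- (sum_trans h n w Hw), <- sumR_scal. apply sumR_ext. intros x _. ring.
  - apply sumR_le. intros x Hx. rewrite <- (Hb (S n) x Hx).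
    rewrite (Rmult_comm _ (h x)), <- sumR_scal.
    eapply Rle_trans; [|apply (sumR_states_le _ n (S (S n))); [lia|]].
    + apply Req_le, sumR_ext. intros; ring.
    + intros w Hw. apply in_states in Hx as [Hx _].
      apply Rmult_le_pos; [auto|]. apply Rmult_le_pos; [auto|apply trans_nonneg].
Qed.

(** * Kac's bound *)

(** Composed with [step], it gives the kernel killed on entering [w]. *)
Definition taboo (w : list nat) (h : list nat -> R) (x : list nat) : R :=
  if weq x w then 0 else h x.

(* [surv w n x]: probability that the chain started at [x] avoids [w] at the times [1..n]. *)
Fixpoint surv (w : list nat) (n : nat) (x : list nat) : R :=
  match n with
  | O => 1
  | S m => step (taboo w (surv w m)) x
  end.

Lemma surv_bounds w n x : 0 <= surv w n x <= 1.
Proof.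
  revert x; induction n as [|n IH]; intros x; simpl; [lra|]. split.
  - rewrite <- (step_const 0 x). apply step_le. intros v _. unfold taboo.
    destruct weq; [lra|apply IH].
  - rewrite <- (step_const 1 x). apply step_le. intros v _. unfold taboo.
    destruct weq; [lra|apply IH].
Qed.

Lemma surv_decr w n x : surv w (S n) x <= surv w n x.
Proof.
  revert x; induction n as [|n IH]; intros x; [apply surv_bounds|].
  apply step_le. intros v _. unfold taboo. destruct weq; [lra|apply IH].
Qed.

Lemma first_ret_cons w x v vs : vs <> [] ->
  first_ret adj w x (v :: vs) =
  if weq (fcfm adj x v) w then false else first_ret adj w (fcfm adj x v) vs.
Proof. destruct vs; [congruence|reflexivity]. Qed.

(** Conditioning on the first arrival reduces to a first passage from the next state, which is why
    the starting point [x] is kept distinct from the target [w]. *)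
Lemma first_ret_sum w n x :
  sumR (words N (S n)) (fun vs => if first_ret adj w x vs then prodmu mu vs else 0) =
  surv w n x - surv w (S n) x.
Proof.
  revert x; induction n as [|n IH]; intros x.
  - rewrite <- (step_const 1 x) at 1. simpl surv. unfold step. rewrite <- sumR_minus.
    rewrite sumR_words_S. simpl. rewrite Rplus_0_r. apply sumR_ext. intros v _.
    unfold taboo. destruct weq; ring.
  - rewrite sumR_words_S, sumR_swap.
    change (surv w (S n) x) with (step (taboo w (surv w n)) x).
    change (surv w (S (S n)) x) with (step (taboo w (surv w (S n))) x).
    unfold step. rewrite <- sumR_minus. apply sumR_ext. intros v _.
    transitivity (mu v * (if weq (fcfm adj x v) w then 0 else
      sumR (words N (S n))
        (fun vs => if first_ret adj w (fcfm adj x v) vs then prodmu mu vs else 0))).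
    + destruct (weq (fcfm adj x v) w) eqn:E.
      * rewrite Rmult_0_r. apply sumR_0. intros t Ht.
        rewrite first_ret_cons, E; [reflexivity|].
        intros ->. apply in_words in Ht as [Ht _]. discriminate.
      * rewrite <- sumR_scal. apply sumR_ext. intros t Ht.
        rewrite first_ret_cons, E.
        -- simpl. destruct first_ret; ring.
        -- intros ->. apply in_words in Ht as [Ht _]. discriminate.
    + unfold taboo. destruct weq; [ring|]. rewrite IH. ring.
Qed.

Lemma ret_prob_0 w : ret_prob N adj mu w 0 = 0.
Proof. unfold ret_prob. simpl. ring. Qed.

Lemma ret_prob_S w n : ret_prob N adj mu w (S n) = surv w n w - surv w (S n) w.
Proof. apply first_ret_sum. Qed.

Lemma sum_ret_prob w n : sum_f_R0 (ret_prob N adj mu w) n = 1 - surv w n w.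
Proof.
  induction n as [|n IH]; [cbn [sum_f_R0]; rewrite ret_prob_0; simpl; ring|].
  cbn [sum_f_R0]. rewrite IH, ret_prob_S. ring.
Qed.

Lemma ret_prob_nonneg w n : 0 <= ret_prob N adj mu w n.
Proof.
  destruct n; [rewrite ret_prob_0; lra|]. rewrite ret_prob_S.
  pose proof (surv_decr w n w). lra.
Qed.

(** Summation by parts: the truncated mean return time is a sum of survival probabilities, up to a
    boundary term. *)
Lemma sum_n_ret_prob w n :
  sum_f_R0 (fun k => INR k * ret_prob N adj mu w k) (S n) =
  sum_f_R0 (fun k => surv w k w) n - INR (S n) * surv w (S n) w.
Proof.
  induction n as [|n IH].
  - cbn [sum_f_R0]. rewrite ret_prob_S. cbn [surv INR]. ring.
  - rewrite tech5, IH, ret_prob_S, (tech5 _ n), (S_INR (S n)). ring.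
Qed.

(* Kac's formula, as an inequality: by stationarity, [p w * surv w k w] is the difference of
   the probabilities under [p] of avoiding [w] for [k] and for [k + 1] consecutive times. *)
Lemma kac p w n : nonnegW p -> balanced p -> inW N adj w = true ->
  forall L, (length w + n <= L)%nat ->
  p w * sum_f_R0 (fun k => surv w k w) n <= sumR (states (S L)) p.
Proof.
  intros Hp Hb Hw.
  (* The functions [surv w k] and [taboo w (surv w k)] differ only at [w], so their integrals
     against [p] differ by the left side; [balanced_step_le] handles the second one. *)
  assert (Hstep : forall k L, (length w <= L)%nat ->
    p w * surv w k w <= sumR (states (S L)) (fun x => p x * surv w k x)
                        - sumR (states L) (fun x => p x * surv w (S k) x)).
  { intros k L HL.
    pose proof (balanced_step_le p (taboo w (surv w k)) L Hp Hb) as H.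
    assert (nonnegW (taboo w (surv w k))) as Ht.
    { intros x _. unfold taboo. destruct weq; [lra|apply surv_bounds]. }
    specialize (H Ht).
    assert (sumR (states (S L)) (fun x => p x * surv w k x)
            - sumR (states (S L)) (fun x => p x * taboo w (surv w k) x)
            = p w * surv w k w) as E.
    { rewrite <- sumR_minus. rewrite (sumR_single _ _ w).
      - unfold taboo. rewrite (proj2 (weq_spec w w)) by reflexivity. ring.
      - apply NoDup_states.
      - apply in_states; split; [auto|lia].
      - intros x _ Hx. unfold taboo. destruct (weq_reflect x w); [congruence|ring]. }
    change (surv w (S k)) with (step (taboo w (surv w k))). lra. }
  (* The bound for time [k] is taken at truncation level [L - k]: each step in time costs one unit
     of length, and with this choice consecutive bounds telescope. *)
  assert (Hk : forall L, (length w + n <= L)%nat ->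
    p w * sum_f_R0 (fun k => surv w k w) n <= sumR (states (S L)) p
      - sumR (states (L - n)) (fun x => p x * surv w (S n) x)).
  { induction n as [|n IH]; intros L HL.
    - cbn [sum_f_R0]. rewrite Nat.sub_0_r.
      assert (sumR (states (S L)) (fun x => p x * surv w 0 x) = sumR (states (S L)) p) as <-
        by (apply sumR_ext; intros; simpl; ring).
      apply Hstep. lia.
    - cbn [sum_f_R0]. rewrite Rmult_plus_distr_l.
      specialize (IH L ltac:(lia)). specialize (Hstep (S n) (L - S n)%nat ltac:(lia)).
      replace (S (L - S n)) with (L - n)%nat in Hstep by lia. lra. }
  intros L HL. specialize (Hk L HL).
  assert (0 <= sumR (states (L - n)) (fun x => p x * surv w (S n) x)); [|lra].
  apply sumR_nonneg. intros x Hx. apply in_states in Hx as [Hx _].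
  apply Rmult_le_pos; [auto|apply surv_bounds].
Qed.

Lemma surv_mul_le w n : INR n * surv w n w <= sum_f_R0 (fun k => surv w k w) n.
Proof.
  induction n as [|n IH]; [simpl; lra|].
  rewrite tech5, S_INR. pose proof (surv_decr w n w). pose proof (pos_INR n).
  assert (INR n * surv w (S n) w <= INR n * surv w n w) by now apply Rmult_le_compat_l.
  lra.
Qed.

(** By [kac], the survival probabilities have sum at most [/ p w]. As they decrease, the one at time
    [n] is at most [/ p w] divided by [n], hence the return is almost sure; the same constant bounds
    the mean return time. *)
Lemma positive_stationary_recurrent p w :
  stationary N adj mu p -> inW N adj w = true -> 0 < p w ->
  pos_recurrent_state N adj mu w.
Proof.
  rewrite stationary_balanced. intros (Hp & Hcv & Hb) Hw Hpw.
  assert (HC : forall n, sum_f_R0 (fun k => surv w k w) n <= / p w).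
  { intros n. apply Rmult_le_reg_l with (p w); [exact Hpw|]. rewrite Rinv_r by lra.
    eapply Rle_trans; [apply (kac p w n Hp Hb Hw (length w + n)); lia|].
    apply (growing_ineq (fun n => sumR (states n) p)); [|exact Hcv].
    intros m. apply sumR_states_le; auto. }
  split.
  - intros eps He. destruct (INR_unbounded (/ p w / eps)) as [n0 Hn0].
    exists n0. intros n Hn. unfold Rdist. rewrite sum_ret_prob.
    replace (1 - surv w n w - 1) with (- surv w n w) by ring.
    rewrite Rabs_Ropp, Rabs_pos_eq by apply surv_bounds.
    assert (H : INR n * surv w n w <= / p w) by (eapply Rle_trans; [apply surv_mul_le|apply HC]).
    assert (Hn' : / p w / eps < INR n) by (eapply Rlt_le_trans; [exact Hn0|now apply le_INR]).
    apply Rmult_lt_compat_r with (r := eps) in Hn'; [|lra].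
    unfold Rdiv in Hn'. rewrite Rmult_assoc, Rinv_l, Rmult_1_r in Hn' by lra.
    destruct (Rlt_le_dec (surv w n w) eps) as [|Hs]; [assumption|].
    pose proof (pos_INR n).
    assert (INR n * eps <= INR n * surv w n w) by now apply Rmult_le_compat_l. lra.
  - destruct (growing_cv (sum_f_R0 (fun n => INR n * ret_prob N adj mu w n))) as [m Hm].
    + intros n. rewrite tech5. pose proof (ret_prob_nonneg w (S n)).
      pose proof (pos_INR (S n)). assert (0 <= INR (S n) * ret_prob N adj mu w (S n))
        by now apply Rmult_le_pos. lra.
    + exists (/ p w). intros y [n ->]. destruct n as [|n].
      * simpl. rewrite Rmult_0_l. now apply Rlt_le, Rinv_0_lt_compat.
      * rewrite sum_n_ret_prob. specialize (HC n).
        assert (0 <= INR (S n) * surv w (S n) w); [|lra].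
        apply Rmult_le_pos; [apply pos_INR|apply surv_bounds].
    + now exists m.
Qed.

(** * Uniqueness *)

Lemma sumR_states_step f n :
  (forall w, inW N adj w = true -> f w <= 0) ->
  sumR (states (S n)) f <= sumR (states n) f.
Proof.
  intros Hf. rewrite states_S, sumR_app.
  assert (0 <= sumR (filter (inW N adj) (words N (S n))) (fun w => - f w)) as H.
  { apply sumR_nonneg. intros w Hw. apply filter_In in Hw as [_ Hw]. apply Hf in Hw. lra. }
  rewrite (sumR_ext _ (fun w => - f w) (fun w => (-1) * f w)), sumR_scal in H
    by (intros; ring). lra.
Qed.

(* The minimum of two stationary measures is superinvariant, and invariant because
   its total mass is finite. *)
Lemma min_balanced p q s : nonnegW p -> nonnegW q -> balanced p -> balanced q ->
  Un_cv (fun n => sumR (states n) q) s ->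
  balanced (fun w => Rmin (p w) (q w)).
Proof.
  intros Hp Hq Hbp Hbq Hcv. set (m := fun w => Rmin (p w) (q w)).
  assert (Hm : nonnegW m) by (intros w Hw; apply Rmin_glb; auto).
  (* The defect of the minimum in the balance equation, to be shown equal to zero. *)
  set (d := fun n x => m x - sumR (states (S n)) (fun w => m w * trans N adj mu w x)).
  assert (Hd : forall n x, In x (states n) -> 0 <= d n x).
  { intros n x Hx. unfold d.
    assert (sumR (states (S n)) (fun w => m w * trans N adj mu w x) <= m x); [|lra].
    apply Rmin_glb; [rewrite <- (Hbp n x Hx)|rewrite <- (Hbq n x Hx)];
      apply sumR_le; intros w _; apply Rmult_le_compat_r;
      first [apply trans_nonneg|apply Rmin_l|apply Rmin_r]. }
  (* All the mass that [m] puts on [states n] is carried into [states (S n)], so the total defect is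
     at most the mass of [m] on words of length [S n], and [m] is at most [q]. *)
  assert (Hsum : forall n, sumR (states (S n)) (d (S n)) <=
                           sumR (states (S n)) q - sumR (states n) q).
  { intros n.
    assert (H : sumR (states n) m <= sumR (states (S n))
      (fun x => sumR (states (S (S n))) (fun w => m w * trans N adj mu w x))).
    { rewrite sumR_swap. rewrite (sumR_ext (states n) m
        (fun w => sumR (states (S n)) (fun x => m w * trans N adj mu w x))).
      - apply sumR_states_le; [lia|]. intros w Hw. apply sumR_nonneg. intros x _.
        apply Rmult_le_pos; [auto|apply trans_nonneg].
      - intros w Hw. rewrite sumR_scal.
        rewrite (sumR_ext _ _ (fun x => trans N adj mu w x * 1)) by (intros; ring).
        rewrite (sum_trans (fun _ => 1) n w Hw), step_const. ring. }
    unfold d. rewrite sumR_minus.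
    pose proof (sumR_states_step (fun w => m w - q w) n) as H'.
    rewrite !sumR_minus in H'.
    assert (sumR (states (S n)) m - sumR (states (S n)) q
            <= sumR (states n) m - sumR (states n) q); [|lra].
    apply H'. intros w _. unfold m. pose proof (Rmin_r (p w) (q w)). lra. }
  intros n x Hx. assert (H0 : d n x = 0); [|unfold d in H0; fold (m x); lra].
  apply Rle_antisym; [|now apply Hd]. apply le_epsilon. intros eps He.
  (* The mass of [q] on words of a given large length is below [eps], whereas the defect at [x] does
     not depend on the truncation level once that is at least the length of [x]. *)
  destruct (CV_Cauchy _ (exist _ s Hcv) eps He) as [n0 Hn0].
  set (k := Nat.max n0 n). specialize (Hn0 (S k) k ltac:(lia) ltac:(lia)).
  unfold Rdist in Hn0. apply Rabs_def2 in Hn0. specialize (Hsum k).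
  assert (Hxk : In x (states (S k))).
  { apply in_states in Hx as [HW Hl]. apply in_states. split; auto. lia. }
  assert (d (S k) x <= sumR (states (S k)) (d (S k)))
    by (apply sumR_ge_term; auto).
  assert (d n x = d (S k) x); [|lra].
  unfold d. f_equal. apply in_states in Hx as Hx'.
  rewrite (sum_trans_stable m x (S n)), (sum_trans_stable m x (S (S k))) by lia.
  reflexivity.
Qed.

(** Induction on the last letter. Scale [p] by [c] to agree with [q] at [x]; their minimum is
    invariant and agrees with both at [x], which forces agreement at every predecessor of [x], in
    particular at the prefix [w]. So the ratio at [x] is the ratio at [w]. *)
Lemma stationary_ratio p q s : nonnegW q -> (forall w, inW N adj w = true -> 0 < p w) ->
  balanced p -> balanced q ->
  Un_cv (fun n => sumR (states n) q) s ->
  forall w, inW N adj w = true -> q w = q [] / p [] * p w.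
Proof.
  intros Hq Hp Hbp Hbq Hcvq w.
  assert (Hp0 : 0 < p []) by now apply Hp.
  induction w as [|v w IH] using rev_ind; intros Hw; [field; lra|].
  assert (Hw' : inW N adj w = true)
    by (apply (inW_incl w (w ++ [v])); auto; apply incl_appl, incl_refl).
  specialize (IH Hw').
  set (x := w ++ [v]) in *. pose proof (Hp x Hw) as Hpx.
  set (c := q x / p x).
  assert (Hc : 0 <= c) by (apply Rle_mult_inv_pos; auto).
  assert (Hbc : balanced (fun w => c * p w)).
  { intros n y Hy. rewrite <- (Hbp n y Hy), <- sumR_scal. apply sumR_ext. intros; ring. }
  assert (Hnc : nonnegW (fun w => c * p w)).
  { intros y Hy. apply Rmult_le_pos; auto. now apply Rlt_le, Hp. }
  pose proof (min_balanced _ q s Hnc Hq Hbc Hbq Hcvq) as Hmin.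
  assert (Hcx : c * p x = q x) by (unfold c; field; lra).
  assert (Hxs : In x (states (length x))) by (apply in_states; auto).
  assert (Hws : In w (states (S (length x)))).
  { apply in_states. split; auto. unfold x. rewrite length_app. lia. }
  pose proof (trans_snoc_pos w v Hw) as Ht. fold x in Ht.
  (* Subtracting the balance equations at [x] leaves a vanishing sum of nonnegative terms; the term
     of [w] carries a positive transition probability. This is applied to both [q] and the scaled
     [p]. *)
  assert (Heq : forall f, balanced f -> f x = Rmin (c * p x) (q x) ->
    (forall y, Rmin (c * p y) (q y) <= f y) -> f w = Rmin (c * p w) (q w)).
  { intros f Hbf Hfx Hle.
    assert (E : sumR (states (S (length x)))
      (fun y => f y * trans N adj mu y x - Rmin (c * p y) (q y) * trans N adj mu y x) = 0).
    { rewrite sumR_minus, (Hbf _ x Hxs), (Hmin _ x Hxs). lra. }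
    pose proof (fun H => sumR_eq0 _ _ w H E Hws) as Z. cbv beta in Z.
    rewrite <- Rmult_minus_distr_r in Z.
    destruct (Rmult_integral (f w - Rmin (c * p w) (q w)) (trans N adj mu w x)) as [|]; try lra.
    apply Z. intros y _. rewrite <- Rmult_minus_distr_r.
    apply Rmult_le_pos; [|apply trans_nonneg]. specialize (Hle y). lra. }
  assert (c * p w = q w) as Hcw.
  { rewrite (Heq q), <- (Heq (fun w => c * p w)); auto.
    - rewrite Hcx, Rmin_left; lra.
    - intros; apply Rmin_l.
    - rewrite Hcx, Rmin_left; lra.
    - intros; apply Rmin_r. }
  rewrite IH in Hcw. pose proof (Hp w Hw').
  apply Rmult_eq_reg_r in Hcw; [|lra]. rewrite <- Hcw. symmetry. exact Hcx.
Qed.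

(** * Necessity of Ncond *)

Lemma nbhd_spec (I : nat -> bool) v :
  nbhd adj I N v = true <-> exists u, I u = true /\ adj u v = true.
Proof.
  unfold nbhd. rewrite existsb_exists. split.
  - intros (u & _ & E). apply andb_true_iff in E. eauto.
  - intros (u & Hu & E). exists u. rewrite Hu, E. split; auto.
    apply in_vert. now apply Hg in E.
Qed.

(** Turns a bound valid for each arrival into a drift bound for the mean. *)
Lemma step_lower (f g : list nat -> R) (b : nat -> R) x :
  (forall v, inV N v -> f x + b v <= g (fcfm adj x v)) ->
  f x + sumR (vert N) (fun v => mu v * b v) <= step g x.
Proof.
  intros H. rewrite <- (step_const (f x) x) at 1. unfold step at 1.
  rewrite <- sumR_plus. apply sumR_le. intros v Hv.
  pose proof (mu_vert v Hv). apply in_vert in Hv.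
  rewrite <- Rmult_plus_distr_l. apply Rmult_le_compat_l; [lra|auto].
Qed.

Definition score (I : nat -> bool) (x : nat) : R :=
  (if I x then 1 else 0) - (if nbhd adj I N x then 1 else 0).

Definition wscore (I : nat -> bool) (w : list nat) : R := sumR w (score I).

(* [excursion f n x] is the expectation of [f (W_n)] on the event that the chain started
   at [x] avoids the empty buffer at the times [1..n]. *)
Fixpoint excursion (f : list nat -> R) (n : nat) (x : list nat) : R :=
  match n with
  | O => f x
  | S m => step (taboo [] (excursion f m)) x
  end.

(** The length grows by at most one per arrival, so [f] is at most the initial length plus [n]
    wherever the excursion has survived. *)
Lemma excursion_le f n x : (forall w, f w <= INR (length w)) ->
  excursion f n x <= (INR (length x) + INR n) * surv [] n x.
Proof.
  intros Hf. revert x; induction n as [|n IH]; intros x.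
  - simpl. rewrite Rplus_0_r, Rmult_1_r. apply Hf.
  - cbn [excursion surv]. unfold step at 2. rewrite <- sumR_scal. apply sumR_le.
    intros v Hv. apply mu_vert in Hv. unfold taboo.
    destruct (weq (fcfm adj x v) []); [lra|].
    specialize (IH (fcfm adj x v)). pose proof (surv_bounds [] n (fcfm adj x v)) as Hs.
    assert (INR (length (fcfm adj x v)) + INR n <= INR (length x) + INR (S n)).
    { rewrite <- !plus_INR. apply le_INR. destruct (fcfm_length x v); lia. }
    assert ((INR (length (fcfm adj x v)) + INR n) * surv [] n (fcfm adj x v) <=
            (INR (length x) + INR (S n)) * surv [] n (fcfm adj x v))
      by (apply Rmult_le_compat_r; lra).
    rewrite (Rmult_comm _ (mu v * _)), Rmult_assoc, (Rmult_comm (surv _ _ _)).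
    apply Rmult_le_compat_l; lra.
Qed.

Section Necessity.
Variable I : nat -> bool.
Hypothesis HI : independent N adj I.

(** If one end of the edge is in [I], the other is in its neighbourhood and, by independence, not in
    [I]: the scores are opposite. If neither end is in [I], both scores are at most zero. *)
Lemma score_match u v : adj v u = true -> score I v <= - score I u.
Proof.
  intros Huv. unfold score.
  assert (HE : forall a b, adj a b = true -> I a = true -> nbhd adj I N b = true).
  { intros a b Hab Ha. apply nbhd_spec. eauto. }
  assert (HD : forall a, I a = true -> nbhd adj I N a = false).
  { intros a Ha. destruct (nbhd adj I N a) eqn:E; [|reflexivity].
    apply nbhd_spec in E as (b & Hb & Hab).
    destruct HI as (_ & _ & Hind). rewrite Hind in Hab; auto. }
  pose proof (HE v u Huv). pose proof (HE u v ltac:(now rewrite adjC)).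
  pose proof (HD u). pose proof (HD v).
  destruct (I u), (I v), (nbhd adj I N u), (nbhd adj I N v);
    try lra; exfalso; intuition discriminate.
Qed.

Lemma score_le1 v : score I v <= 1.
Proof. unfold score. destruct (I v), (nbhd adj I N v); lra. Qed.

Lemma wscore_arrival w v : wscore I w + score I v <= wscore I (fcfm adj w v).
Proof.
  unfold wscore. destruct (fcfm_cases w v) as [[_ ->]|(a & u & b & -> & Hu & ->)].
  - rewrite sumR_app. simpl. lra.
  - rewrite !sumR_app. simpl. apply score_match in Hu. lra.
Qed.

Lemma wscore_le_length w : wscore I w <= INR (length w).
Proof.
  induction w as [|x w IH]; [simpl; lra|].
  simpl length. rewrite S_INR. unfold wscore in *. simpl. pose proof (score_le1 x). lra.
Qed.

Lemma sum_mu_score :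
  sumR (vert N) (fun v => mu v * score I v) = muS N mu I - muS N mu (nbhd adj I N).
Proof.
  unfold muS. rewrite <- sumR_minus. apply sumR_ext. intros v _.
  unfold score. destruct (I v), (nbhd adj I N v); ring.
Qed.

(** Otherwise every edge from the neighbourhood of [I] would end in [I]. The union of the two sets
    would then be closed under adjacency, hence everything by connectedness, and membership in [I]
    would be a proper 2-colouring. *)
Lemma escaping_edge : connected N adj -> ~ bipartite N adj ->
  exists u v, nbhd adj I N u = true /\ adj u v = true /\ I v = false.
Proof.
  intros Hconn Hnb. apply NNPP. intros Hno. apply Hnb.
  assert (HEI : forall u v, nbhd adj I N u = true -> adj u v = true -> I v = true).
  { intros u v Hu Hv. destruct (I v) eqn:E; [reflexivity|]. exfalso. apply Hno. eauto. }
  destruct HI as ((i & HiV & Hi) & _ & Hind).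
  assert (Hwalk : forall p x y, is_walk adj x p y ->
    I x = true \/ nbhd adj I N x = true -> I y = true \/ nbhd adj I N y = true).
  { induction p as [|z p IH]; simpl; intros x y Hp Hx; [now subst y|].
    destruct Hp as [Hxz Hp]. apply (IH z y Hp). destruct Hx as [Hx|Hx].
    - right. apply nbhd_spec. eauto.
    - left. eauto. }
  exists I. intros u v Huv E.
  assert (HuV : inV N u) by now apply Hg in Huv.
  destruct (Hconn i u HiV HuV) as [p Hp].
  destruct (Hwalk p i u Hp (or_introl Hi)) as [Hu|Hu].
  - rewrite Hind in Huv; congruence.
  - pose proof (HEI u v Hu Huv) as Hv. rewrite Hind in Huv; congruence.
Qed.

Hypothesis Hge : muS N mu (nbhd adj I N) <= muS N mu I.

(** Killing at the empty buffer costs nothing, because the score vanishes there. *)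
Lemma taboo_nil_lower (f : list nat -> R) w :
  (forall x, wscore I x <= f x) -> wscore I w <= taboo [] f w.
Proof.
  intros H. unfold taboo. destruct (weq_reflect w []) as [->|_]; [|apply H].
  unfold wscore. simpl. lra.
Qed.

(** Submartingale property: the mean score of an arrival is [muS N mu I - muS N mu (nbhd adj I N)],
    nonnegative by [Hge]. *)
Lemma excursion_ge n x : wscore I x <= excursion (wscore I) n x.
Proof.
  revert x; induction n as [|n IH]; intros x; [simpl; lra|].
  apply Rle_trans with (wscore I x + sumR (vert N) (fun v => mu v * score I v)).
  - rewrite sum_mu_score. lra.
  - apply step_lower. intros v _.
    eapply Rle_trans; [apply wscore_arrival|apply taboo_nil_lower, IH].
Qed.

(** An arrival [v] removes [u], raising the score from -1 to 0 although the score of [v] is at most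
    0. The surplus over [wscore_arrival] is at least 1, with probability [mu v]. *)
Lemma excursion_gain u v n :
  nbhd adj I N u = true -> adj u v = true -> I v = false ->
  wscore I [u] + mu v <= excursion (wscore I) (S n) [u].
Proof.
  intros Hu Huv Hv.
  assert (HvV : inV N v) by now apply Hg in Huv.
  apply Rle_trans with (wscore I [u] + sumR (vert N)
    (fun x => mu x * (score I x + if Nat.eqb x v then 1 else 0))).
  - apply Rplus_le_compat_l.
    rewrite (sumR_ext _ _ (fun x => mu x * score I x + (if Nat.eqb x v then mu x else 0)))
      by (intros x _; destruct (Nat.eqb x v); ring).
    rewrite sumR_plus, sum_mu_score, (sumR_single _ (fun x => if Nat.eqb x v then _ else _) v).
    + rewrite Nat.eqb_refl. lra.
    + apply NoDup_vert.
    + now apply in_vert.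
    + intros x _ Hx. apply Nat.eqb_neq in Hx. now rewrite Hx.
  - apply step_lower. intros x _.
    eapply Rle_trans; [|apply taboo_nil_lower, excursion_ge].
    destruct (Nat.eqb_spec x v) as [->|_].
    + simpl. rewrite (adjC v u), Huv. unfold wscore. simpl. unfold score.
      rewrite Hu, Hv.
      assert (I u = false) as ->.
      { destruct HI as (_ & _ & Hind). apply nbhd_spec in Hu as (a & Ha & Hau).
        destruct (I u) eqn:E; [|reflexivity]. rewrite Hind in Hau; congruence. }
      destruct (nbhd adj I N v); lra.
    + rewrite Rplus_0_r. apply wscore_arrival.
Qed.

(** The first two steps produce the bound: [u] arrives in the empty buffer, then the gain of
    [excursion_gain] occurs; afterwards the mean score does not decrease. *)
Lemma excursion_nil_lower u v n :
  nbhd adj I N u = true -> adj u v = true -> I v = false ->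
  mu u * mu v <= excursion (wscore I) (S (S n)) [].
Proof.
  intros Hu Huv Hv.
  assert (HV : inV N u /\ inV N v) by now apply Hg in Huv.
  pose proof (mu_pos u (proj1 HV)). pose proof (mu_pos v (proj2 HV)).
  apply Rle_trans with (wscore I [] + sumR (vert N)
    (fun x => mu x * (score I x + if Nat.eqb x u then mu v else 0))).
  - rewrite (sumR_ext _ _ (fun x =>
      mu x * score I x + (if Nat.eqb x u then mu x * mu v else 0)))
      by (intros x _; destruct (Nat.eqb x u); ring).
    rewrite sumR_plus, sum_mu_score, (sumR_single _ (fun x => if Nat.eqb x u then _ else _) u).
    + rewrite Nat.eqb_refl. unfold wscore. simpl. lra.
    + apply NoDup_vert.
    + now apply in_vert.
    + intros x _ Hx. apply Nat.eqb_neq in Hx. now rewrite Hx.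
  - change (excursion _ _ []) with (step (taboo [] (excursion (wscore I) (S n))) []).
    apply step_lower. intros x _. unfold taboo.
    destruct (weq_reflect (fcfm adj [] x) []) as [E|_]; [discriminate|].
    cbn [fcfm]. destruct (Nat.eqb_spec x u) as [->|_].
    + eapply Rle_trans; [|now apply (excursion_gain u v)]. unfold wscore. simpl. lra.
    + eapply Rle_trans; [|apply excursion_ge]. unfold wscore. simpl. lra.
Qed.
End Necessity.

(** With T the return time, n P(T > n) is at most the mean of T on the event T > n, which is the
    tail of a convergent series. *)
Lemma recurrent_survival w : pos_recurrent_state N adj mu w ->
  Un_cv (fun n => INR n * surv w n w) 0.
Proof.
  intros [H1 [m Hm]].
  set (s := sum_f_R0 (fun n => INR n * ret_prob N adj mu w n)) in Hm.
  assert (Hpart : forall n k, INR n * (surv w n w - surv w (n + k) w) <= s (n + k)%nat - s n).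
  { intros n k. induction k as [|k IH]; [rewrite Nat.add_0_r; lra|].
    rewrite Nat.add_succ_r. unfold s. rewrite tech5, ret_prob_S. fold s.
    pose proof (surv_decr w (n + k) w).
    assert (INR n * (surv w (n + k) w - surv w (S (n + k)) w) <=
            INR (S (n + k)) * (surv w (n + k) w - surv w (S (n + k)) w)); [|lra].
    apply Rmult_le_compat_r; [lra|]. apply le_INR. lia. }
  assert (Hlim : forall n, INR n * surv w n w <= m - s n).
  { intros n. apply le_epsilon. intros eps He.
    pose proof (pos_INR n).
    (* Recurrence makes the survival probability at the late time [n + k] negligible even after
       multiplication by [INR n]; the added 1 avoids a zero denominator at [n = 0]. *)
    destruct (H1 (eps / 2 / (INR n + 1))) as [n1 Hn1]; [apply Rdiv_lt_0_compat; lra|].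
    destruct (Hm (eps / 2)) as [n2 Hn2]; [lra|].
    set (k := (n1 + n2)%nat).
    specialize (Hn1 (n + k)%nat ltac:(lia)). specialize (Hn2 (n + k)%nat ltac:(lia)).
    unfold Rdist in *. rewrite sum_ret_prob in Hn1.
    apply Rabs_def2 in Hn1, Hn2. specialize (Hpart n k).
    pose proof (surv_bounds w (n + k) w).
    assert (INR n * surv w (n + k) w <= (INR n + 1) * (eps / 2 / (INR n + 1)))
      by (apply Rmult_le_compat; lra).
    replace ((INR n + 1) * (eps / 2 / (INR n + 1))) with (eps / 2) in * by (field; lra).
    lra. }
  intros eps He. destruct (Hm eps He) as [n0 Hn0]. exists n0. intros n Hn.
  specialize (Hn0 n Hn). specialize (Hlim n). unfold Rdist in *.
  apply Rabs_def2 in Hn0. rewrite Rminus_0_r, Rabs_pos_eq; [lra|].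
  apply Rmult_le_pos; [apply pos_INR|apply surv_bounds].
Qed.

Lemma recurrent_Ncond : connected N adj -> ~ bipartite N adj ->
  pos_recurrent_state N adj mu [] -> Ncond N adj mu.
Proof.
  intros Hconn Hnb Hrec I HI.
  destruct (Rlt_le_dec (muS N mu I) (muS N mu (nbhd adj I N))) as [|Hge]; [assumption|].
  destruct (escaping_edge I HI Hconn Hnb) as (u & v & Hu & Huv & Hv).
  assert (HV : inV N u /\ inV N v) by now apply Hg in Huv.
  assert (He : 0 < mu u * mu v) by (apply Rmult_lt_0_compat; apply mu_pos; tauto).
  destruct (recurrent_survival [] Hrec _ He) as [n Hn].
  specialize (Hn (S (S n)) ltac:(lia)). unfold Rdist in Hn. apply Rabs_def2 in Hn.
  pose proof (excursion_nil_lower I HI Hge u v n Hu Huv Hv).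
  pose proof (excursion_le (wscore I) (S (S n)) [] (wscore_le_length I)) as Hle.
  simpl length in Hle. rewrite Rplus_0_l in Hle. lra.
Qed.

(** * Invariance of the product form *)

Hypothesis Hdeg : forall u, inV N u -> exists v, adj u v = true.

(** The denominator of the product form, written with [hit] so that appending a letter is governed
    by [hit_snoc]. *)
Definition muN (pre : list nat) : R :=
  sumR (vert N) (fun v => if hit pre v then mu v else 0).

(** Convertible to the set that [piU_aux] passes to [nbhd], so that [muS_nbhd] rewrites its
    denominators. *)
Definition letters (w : list nat) (x : nat) : bool := existsb (Nat.eqb x) w.

Lemma letters_spec w x : letters w x = true <-> In x w.
Proof.
  unfold letters. rewrite existsb_exists. split.
  - intros (y & Hy & E). now apply Nat.eqb_eq in E as ->.
  - intros H. exists x. split; auto. apply Nat.eqb_refl.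
Qed.

Lemma muS_nbhd pre : muS N mu (nbhd adj (letters pre) N) = muN pre.
Proof.
  apply sumR_ext. intros v _.
  replace (nbhd adj (letters pre) N v) with (hit pre v); [reflexivity|].
  apply eq_true_iff_eq. unfold nbhd. rewrite hit_true, existsb_exists. split.
  - intros (a & Ha & E). exists a. split; [apply in_vert; now apply Hg in E|].
    apply letters_spec in Ha. now rewrite Ha, E.
  - intros (a & _ & E). apply andb_true_iff in E as [Ha E]. exists a. split; auto.
    now apply letters_spec.
Qed.

Lemma muN_equiv pre pre' : (forall x, In x pre <-> In x pre') -> muN pre = muN pre'.
Proof. intros H. apply sumR_ext. intros v _. now rewrite (hit_equiv pre pre'). Qed.

Lemma muN_nil : muN [] = 0.
Proof. now apply sumR_0. Qed.

Lemma muN_pos pre u : In u pre -> inV N u -> 0 < muN pre.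
Proof.
  intros Hu HuV. destruct (Hdeg u HuV) as [v Hv].
  assert (inV N v) by now apply Hg in Hv.
  apply Rlt_le_trans with (mu v); [now apply mu_pos|].
  replace (mu v) with (if hit pre v then mu v else 0).
  - apply (sumR_ge_term _ (fun v => if hit pre v then mu v else 0)); [|now apply in_vert].
    intros x Hx. apply mu_vert in Hx. destruct hit; lra.
  - rewrite (proj2 (hit_true pre v)); [reflexivity|eauto].
Qed.

Lemma muN_snoc pre u :
  muN (pre ++ [u]) - muN pre =
  sumR (vert N) (fun v => if hit pre v then 0 else if adj u v then mu v else 0).
Proof.
  unfold muN. rewrite <- sumR_minus. apply sumR_ext. intros v _.
  rewrite hit_snoc. destruct (hit pre v), (adj u v); simpl; ring.
Qed.

Lemma piU_aux_cons pre u r :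
  piU_aux N adj mu pre (u :: r) =
  mu u / muN (pre ++ [u]) * piU_aux N adj mu (pre ++ [u]) r.
Proof. cbn [piU_aux]. now rewrite <- muS_nbhd. Qed.

(** The weights see the prefix only as a set. This allows letters of the prefix to be exchanged in
    the telescoping and repeated letters to be dropped in the summability argument. *)
Lemma piU_aux_equiv r pre pre' : (forall x, In x pre <-> In x pre') ->
  piU_aux N adj mu pre r = piU_aux N adj mu pre' r.
Proof.
  revert pre pre'; induction r as [|u r IH]; intros pre pre' H; [reflexivity|].
  assert (H' : forall x, In x (pre ++ [u]) <-> In x (pre' ++ [u])).
  { intros x. rewrite !in_app_iff, H. tauto. }
  now rewrite !piU_aux_cons, (muN_equiv _ _ H'), (IH _ _ H').
Qed.

Lemma piU_aux_app a b pre :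
  piU_aux N adj mu pre (a ++ b) = piU_aux N adj mu pre a * piU_aux N adj mu (pre ++ a) b.
Proof.
  revert pre; induction a as [|u a IH]; intros pre.
  - simpl. rewrite app_nil_r. ring.
  - rewrite <- app_comm_cons, !piU_aux_cons, IH, <- app_assoc. simpl. ring.
Qed.

Lemma piU_aux_pos r pre : Forall (inV N) r -> 0 < piU_aux N adj mu pre r.
Proof.
  revert pre; induction r as [|u r IH]; intros pre H; [simpl; lra|].
  inversion H; subst. rewrite piU_aux_cons.
  apply Rmult_lt_0_compat; [|now apply IH].
  apply Rdiv_lt_0_compat; [now apply mu_pos|].
  apply (muN_pos _ u); auto. apply in_elt.
Qed.

Lemma piU_pos w : inW N adj w = true -> 0 < piU N adj mu w.
Proof.
  intros H. apply piU_aux_pos. apply inW_words, in_words in H. tauto.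
Qed.

(* Sum of [G] over the words from which an arrival of class [v] leads to [w]
   by matching (and deleting) a letter. *)
Fixpoint ins_sum (v : nat) (w : list nat) (G : list nat -> R) : R :=
  sumR (vert N) (fun u => if adj v u then G (u :: w) else 0) +
  match w with
  | [] => 0
  | x :: r => if adj v x then 0 else ins_sum v r (fun t => G (x :: t))
  end.

Lemma ins_sum_ext v w G G' :
  (forall t, G t = G' t) -> ins_sum v w G = ins_sum v w G'.
Proof.
  revert G G'; induction w as [|x w IH]; intros G G' H; simpl; f_equal.
  - apply sumR_ext. intros u _. now rewrite H.
  - apply sumR_ext. intros u _. now rewrite H.
  - destruct adj; [reflexivity|]. apply IH. intros t. apply H.
Qed.

Lemma ins_sum_scal c v w G : ins_sum v w (fun t => c * G t) = c * ins_sum v w G.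
Proof.
  revert G; induction w as [|x w IH]; intros G; simpl;
    rewrite Rmult_plus_distr_l, <- sumR_scal; f_equal.
  - apply sumR_ext. intros u _. destruct adj; ring.
  - ring.
  - apply sumR_ext. intros u _. destruct adj; ring.
  - destruct adj; [ring|]. apply (IH (fun t => G (x :: t))).
Qed.

(** The first letter of [t] is either matched with [v], and then the rest is [w], or kept, and then
    it is the head of [w] and incompatible with [v]. Thus [ins_sum] stops at the first letter of [w]
    compatible with [v]: beyond it, FCFM would have chosen that letter. *)
Lemma sum_words_ins v w G : Forall (inV N) w ->
  sumR (words N (S (length w))) (fun t => if weq (fcfm adj t v) w then G t else 0) =
  ins_sum v w G.
Proof.
  revert G; induction w as [|y r IH]; intros G Hw.
  - simpl length. rewrite sumR_words_S. simpl. rewrite !Rplus_0_r.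
    apply sumR_ext. intros u _. destruct adj; [reflexivity|].
    destruct (weq_reflect [u; v] []); [discriminate|reflexivity].
  - inversion Hw as [|? ? Hy Hr]; subst. rewrite sumR_words_S.
    transitivity (sumR (words N (length (y :: r))) (fun t =>
       (if weq t (y :: r) then sumR (vert N) (fun u => if adj v u then G (u :: t) else 0)
        else 0) +
       (if adj v y then 0 else if weq (fcfm adj t v) r then G (y :: t) else 0))).
    { apply sumR_ext. intros t _.
      transitivity (sumR (vert N) (fun u =>
        (if adj v u then if weq t (y :: r) then G (u :: t) else 0 else 0) +
        (if adj v u then 0 else if weq (u :: fcfm adj t v) (y :: r) then G (u :: t) else 0))).
      { apply sumR_ext. intros u _. simpl. destruct (adj v u); ring. }
      rewrite sumR_plus. f_equal.
      - destruct weq; [reflexivity|]. apply sumR_0. intros u _. now destruct adj.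
      - rewrite (sumR_single _ _ y); [|apply NoDup_vert|now apply in_vert|].
        + destruct adj; [reflexivity|].
          destruct (weq_reflect (y :: fcfm adj t v) (y :: r)),
            (weq_reflect (fcfm adj t v) r); congruence.
        + intros u _ Hu. destruct adj; [reflexivity|].
          destruct (weq_reflect (u :: fcfm adj t v) (y :: r)); congruence. }
    rewrite sumR_plus. cbn [ins_sum]. f_equal.
    + rewrite (sumR_single _ _ (y :: r)).
      * now rewrite (proj2 (weq_spec _ _)).
      * apply NoDup_words.
      * now apply in_words.
      * intros t _ Ht. destruct (weq_reflect t (y :: r)); congruence.
    + destruct (adj v y); [now apply sumR_0|]. now apply IH.
Qed.

(** For [u] inserted between [pre] and [rest], the arrivals that select it are adjacent to [u] but
    to no letter of [pre]. Their mass is [muN (pre ++ [u]) - muN pre], whence the factor on the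
    right. *)
Lemma insertion_here rest pre : inW N adj (pre ++ rest) = true ->
  sumR (vert N) (fun v => if hit pre v then 0 else mu v * sumR (vert N) (fun u =>
    if adj v u then
      if inW N adj (pre ++ u :: rest) then piU_aux N adj mu pre (u :: rest) else 0
    else 0))
  = sumR (vert N) (fun u => if hit (pre ++ rest) u then 0 else
      mu u * ((1 - muN pre / muN (pre ++ [u])) * piU_aux N adj mu (pre ++ [u]) rest)).
Proof.
  intros HW.
  transitivity (sumR (vert N) (fun v => sumR (vert N) (fun u =>
    if hit (pre ++ rest) u then 0 else piU_aux N adj mu pre (u :: rest) *
    (if hit pre v then 0 else if adj u v then mu v else 0)))).
  { apply sumR_ext. intros v _. destruct (hit pre v) eqn:E.
    - symmetry. apply sumR_0. intros u _.
      destruct (hit (pre ++ rest) u); [reflexivity|apply Rmult_0_r].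
    - rewrite <- sumR_scal. apply sumR_ext. intros u Hu. apply in_vert in Hu.
      rewrite (inW_equiv _ (u :: pre ++ rest)), inW_cons, HW, (adjC v u) by
        (auto; intros y; simpl; rewrite !in_app_iff; simpl; tauto).
      destruct (hit (pre ++ rest) u), (adj u v); simpl; ring. }
  rewrite sumR_swap. apply sumR_ext. intros u Hu. apply in_vert in Hu.
  destruct hit; [now apply sumR_0|].
  rewrite sumR_scal, <- muN_snoc, piU_aux_cons.
  assert (0 < muN (pre ++ [u])) by (apply (muN_pos _ u); auto; apply in_elt).
  field. lra.
Qed.

(* With [w = w_1 ... w_q], [e_l = muN (w_1 ... w_l)] and [e'_l = muN (u w_1 ... w_l)], the
   words obtained by inserting [u] into [w] contribute a sum over the position [i] of
   [(e'_i - e_i) / (e_1 ... e_i e'_i ... e'_q)], which telescopes. Here [pre = w_1 ... w_j]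
   and the positions are restricted to [i >= j]. *)
Lemma insertion_telescope rest pre : inW N adj (pre ++ rest) = true ->
  sumR (vert N) (fun v => if hit pre v then 0 else
    mu v * ins_sum v rest (fun t => if inW N adj (pre ++ t) then piU_aux N adj mu pre t else 0))
  = sumR (vert N) (fun u => if hit (pre ++ rest) u then 0 else
      mu u * (piU_aux N adj mu pre rest
              - muN pre / muN (pre ++ [u]) * piU_aux N adj mu (pre ++ [u]) rest)).
Proof.
  revert pre; induction rest as [|x r IH]; intros pre HW.
  - rewrite (sumR_ext _ _ (fun v => if hit pre v then 0 else mu v * sumR (vert N) (fun u =>
      if adj v u then
        if inW N adj (pre ++ [u]) then piU_aux N adj mu pre [u] else 0
      else 0))).
    + rewrite insertion_here by exact HW. apply sumR_ext. intros u _.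
      destruct hit; simpl; ring.
    + intros v _. simpl. now rewrite Rplus_0_r.
  (* The factor of [x], common to all words in which [u] is inserted after [x]. *)
  - set (K := mu x / muN (pre ++ [x])).
    transitivity (
      sumR (vert N) (fun v => if hit pre v then 0 else mu v * sumR (vert N) (fun u =>
        if adj v u then
          if inW N adj (pre ++ u :: x :: r) then piU_aux N adj mu pre (u :: x :: r) else 0
        else 0)) +
      K * sumR (vert N) (fun v => if hit (pre ++ [x]) v then 0 else mu v *
        ins_sum v r (fun t => if inW N adj ((pre ++ [x]) ++ t)
                              then piU_aux N adj mu (pre ++ [x]) t else 0))).
    { rewrite <- sumR_scal, <- sumR_plus. apply sumR_ext. intros v _.
      rewrite hit_snoc. destruct (hit pre v); cbn [orb]; [ring|].
      cbn [ins_sum]. rewrite (adjC v x).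
      destruct (adj x v); [ring|].
      rewrite (ins_sum_ext _ _ (fun t => if inW N adj (pre ++ x :: t)
        then piU_aux N adj mu pre (x :: t) else 0) (fun t => K * (if inW N adj ((pre ++ [x]) ++ t)
                              then piU_aux N adj mu (pre ++ [x]) t else 0))).
      - rewrite ins_sum_scal. ring.
      - intros t. rewrite <- app_assoc, piU_aux_cons. simpl. fold K.
        destruct (inW N adj (pre ++ x :: t)); ring. }
    rewrite insertion_here, IH by (rewrite <- ?app_assoc; exact HW).
    rewrite <- sumR_scal, <- sumR_plus. apply sumR_ext. intros u Hu. apply in_vert in Hu.
    rewrite <- app_assoc. simpl app at 2. destruct hit; [ring|].
    (* Since [u x] and [x u] have the same letters, the subtracted term of the induction hypothesis
       cancels the leading term of [insertion_here]. *)
    assert (Hperm : forall y, In y ((pre ++ [u]) ++ [x]) <-> In y ((pre ++ [x]) ++ [u])).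
    { intros y. rewrite !in_app_iff. tauto. }
    rewrite !piU_aux_cons, (muN_equiv _ _ Hperm), (piU_aux_equiv r _ _ Hperm).
    assert (Hx : inV N x) by (apply inW_spec in HW as [HW _]; apply HW, in_elt).
    assert (0 < muN (pre ++ [u])) by (apply (muN_pos _ u); auto; apply in_elt).
    assert (0 < muN (pre ++ [x])) by (apply (muN_pos _ x); auto; apply in_elt).
    assert (0 < muN ((pre ++ [x]) ++ [u])) by (apply (muN_pos _ u); auto; apply in_elt).
    unfold K. field. lra.
Qed.

(** The telescoping from the empty prefix, where [muN] vanishes, gives [mu u * piU N adj mu x] for
    each [u] that can be inserted. These are the [u] adjacent to no letter of [x], of total mass
    [1 - muN x]. *)
Lemma sum_words_longer x : inW N adj x = true ->
  sumR (words N (S (length x)))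
    (fun w => if inW N adj w then piU N adj mu w * trans N adj mu w x else 0)
  = piU N adj mu x * (1 - muN x).
Proof.
  intros Hx.
  set (G := fun w => if inW N adj w then piU N adj mu w else 0).
  (* The guard [hit [] v] is always false; it gives the sum the shape of [insertion_telescope]. *)
  transitivity (sumR (vert N) (fun v => if hit [] v then 0 else mu v * ins_sum v x G)).
  { rewrite (sumR_ext (vert N) _ (fun v => sumR (words N (S (length x)))
      (fun w => mu v * (if weq (fcfm adj w v) x then G w else 0)))).
    - rewrite <- sumR_swap. apply sumR_ext. intros w _. unfold trans, G.
      destruct (inW N adj w); [rewrite <- sumR_scal|symmetry; apply sumR_0; intros v _].
      + apply sumR_ext. intros v _. destruct (weq (fcfm adj w v) x); ring.
      + destruct (weq (fcfm adj w v) x); ring.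
    - intros v _. rewrite sumR_scal, sum_words_ins; [reflexivity|].
      apply inW_words, in_words in Hx. tauto. }
  etransitivity; [exact (insertion_telescope x [] Hx)|].
  unfold piU.
  rewrite muN_nil, <- sum_mu. unfold muN. rewrite <- sumR_minus, <- sumR_scal.
  apply sumR_ext. intros u _. simpl app. destruct (hit x u); unfold Rdiv; ring.
Qed.

(** The only predecessor of this length is [w], with [z] arriving unmatched; [muN (w ++ [z])] clears
    the denominator of the last factor. *)
Lemma sum_words_shorter w z : inW N adj (w ++ [z]) = true ->
  sumR (words N (length w))
    (fun t => if inW N adj t then piU N adj mu t * trans N adj mu t (w ++ [z]) else 0)
  = piU N adj mu (w ++ [z]) * muN (w ++ [z]).
Proof.
  intros HW. pose proof HW as HW'. apply inW_spec in HW' as [HV HA].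
  assert (Hz : inV N z) by apply HV, in_elt.
  assert (Hw : inW N adj w = true)
    by (apply (inW_incl w (w ++ [z])); auto; apply incl_appl, incl_refl).
  assert (Hh : hit w z = false).
  { apply hit_false. intros a Ha. apply HA; rewrite in_app_iff; simpl; auto. }
  assert (Hf : forall t v, length t = length w -> fcfm adj t v = w ++ [z] -> t = w /\ v = z).
  { intros t v Hl E. destruct (fcfm_cases t v) as [[_ E']|(a & u & b & -> & _ & E')];
      rewrite E' in E.
    - now apply app_inj_tail in E.
    - apply (f_equal (@length nat)) in E. rewrite !length_app in *. simpl in *. lia. }
  rewrite (sumR_single _ _ w (NoDup_words _ _)).
  - rewrite Hw. unfold trans. rewrite (sumR_single _ _ z (NoDup_vert _)).
    + rewrite fcfm_no_hit, (proj2 (weq_spec _ _)) by auto.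
      unfold piU. rewrite piU_aux_app, piU_aux_cons. simpl.
      assert (0 < muN (w ++ [z])) by (apply (muN_pos _ z); auto; apply in_elt).
      field. lra.
    + now apply in_vert.
    + intros v _ Hv. destruct (weq_reflect (fcfm adj w v) (w ++ [z])) as [E|]; auto.
      apply Hf in E as [_ E]; auto. contradiction.
  - now apply inW_words.
  - intros t Ht Hne. destruct (inW N adj t); [|reflexivity].
    unfold trans. rewrite sumR_0; [ring|]. intros v _.
    destruct (weq_reflect (fcfm adj t v) (w ++ [z])) as [E|]; auto.
    apply in_words in Ht as [Ht _]. apply Hf in E as [E _]; auto. contradiction.
Qed.

(** Longer predecessors contribute the fraction [1 - muN x] of the weight and shorter ones the
    fraction [muN x]. The empty word has no shorter predecessor, consistently with [muN_nil]. *)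
Lemma piU_balanced : balanced (piU N adj mu).
Proof.
  intros n x Hx. pose proof Hx as HW. apply in_states in HW as [HW Hl].
  rewrite (sum_trans_stable _ x) by lia.
  rewrite <- sumW_partial_states. unfold sumW_partial.
  set (F := fun k => sumR (words N k) _).
  assert (H0 : forall k, k <> S (length x) -> S k <> length x -> F k = 0).
  { intros k H1 H2. apply sumR_0. intros w Hw. apply in_words in Hw as [Hw _].
    rewrite trans_far by lia. destruct (inW N adj w); ring. }
  rewrite tech5.
  assert (HF : F (S (length x)) = piU N adj mu x * (1 - muN x)) by now apply sum_words_longer.
  rewrite HF. destruct x as [|z w _] using rev_ind.
  - simpl length. cbn [sum_f_R0]. rewrite H0, muN_nil by (simpl; lia). ring.
  - rewrite length_app, Nat.add_1_r in *. rewrite tech5, (H0 (S (length w))) by lia.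
    rewrite sum_f_R0_last by (intros; apply H0; lia).
    unfold F. rewrite sum_words_shorter by exact HW. ring.
Qed.

(** * Summability *)

(** Weight of the admissible continuations of [pre] by at most [n] letters, relative to the weight
    of [pre]; for the empty prefix, the partial mass of [piU]. *)
Definition tail_sum (n : nat) (pre : list nat) : R :=
  sum_f_R0 (fun k => sumR (words N k)
    (fun w => if inW N adj (pre ++ w) then piU_aux N adj mu pre w else 0)) n.

Lemma tail_sum_equiv n pre pre' : (forall x, In x pre <-> In x pre') ->
  tail_sum n pre = tail_sum n pre'.
Proof.
  intros H. apply sum_eq. intros k _. apply sumR_ext. intros w _.
  rewrite (piU_aux_equiv w pre pre' H), (inW_equiv (pre ++ w) (pre' ++ w)); [reflexivity|].
  intros x. rewrite !in_app_iff, H. tauto.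
Qed.

Lemma tail_sum_out n pre : inW N adj pre = false -> tail_sum n pre = 0.
Proof.
  intros H. apply sum_eq_R0. intros k _. apply sumR_0. intros w _.
  destruct (inW N adj (pre ++ w)) eqn:E; [|reflexivity].
  rewrite (inW_incl pre (pre ++ w)) in H; [discriminate| |exact E].
  apply incl_appl, incl_refl.
Qed.

Lemma tail_sum_0 pre : inW N adj pre = true -> tail_sum 0 pre = 1.
Proof. intros H. unfold tail_sum. simpl. rewrite app_nil_r, H. ring. Qed.

(** Decomposition by the first letter of the continuation; the 1 is the empty continuation. *)
Lemma tail_sum_S n pre : inW N adj pre = true ->
  tail_sum (S n) pre =
  1 + sumR (vert N) (fun u => mu u / muN (pre ++ [u]) * tail_sum n (pre ++ [u])).
Proof.
  intros H. rewrite <- (tail_sum_0 pre H). unfold tail_sum at 1.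
  rewrite decomp_sum by lia. simpl pred. f_equal.
  induction n as [|n IH]; [|rewrite tech5, IH]; clear H.
  - cbn [sum_f_R0]. rewrite sumR_words_S, sumR_swap. apply sumR_ext. intros u _.
    unfold tail_sum. cbn [sum_f_R0]. rewrite <- sumR_scal. apply sumR_ext. intros w _.
    rewrite <- app_assoc, piU_aux_cons. simpl.
    destruct (inW N adj (pre ++ u :: w)); ring.
  - rewrite sumR_words_S, sumR_swap, <- sumR_plus. apply sumR_ext. intros u _.
    unfold tail_sum. rewrite (tech5 _ n), Rmult_plus_distr_l. f_equal.
    rewrite <- sumR_scal. apply sumR_ext. intros w _.
    rewrite <- app_assoc, piU_aux_cons. simpl app.
    destruct (inW N adj (pre ++ u :: w)); ring.
Qed.

Lemma common_bound (l : list nat) (F : nat -> nat -> R) :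
  (forall u, In u l -> exists B, forall n, F u n <= B) ->
  exists C, 0 <= C /\ forall u n, In u l -> F u n <= C.
Proof.
  induction l as [|a l IH]; intros H.
  - exists 0. split; [lra|easy].
  - destruct IH as (C & HC & HCl); [intros; apply H; now right|].
    destruct (H a (or_introl eq_refl)) as [B HB].
    exists (Rmax B C). split; [eapply Rle_trans; [exact HC|apply Rmax_r]|].
    intros u n [<-|Hu].
    + eapply Rle_trans; [apply HB|apply Rmax_l].
    + eapply Rle_trans; [now apply HCl|apply Rmax_r].
Qed.

(** The bound is the fixed point of the affine recursion. *)
Lemma affine_recursion_bound (T : nat -> R) K rho :
  0 <= K -> 0 <= rho < 1 -> T O <= K -> (forall n, T (S n) <= K + rho * T n) ->
  forall n, T n <= K / (1 - rho).
Proof.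
  intros HK Hr H0 HS n.
  assert (E : K + rho * (K / (1 - rho)) = K / (1 - rho)) by (field; lra).
  assert (0 <= rho * (K / (1 - rho))).
  { apply Rmult_le_pos; [lra|]. apply Rle_mult_inv_pos; lra. }
  induction n as [|n IH]; [lra|]. specialize (HS n).
  assert (rho * T n <= rho * (K / (1 - rho))) by (apply Rmult_le_compat_l; lra). lra.
Qed.

Hypothesis Hcond : Ncond N adj mu.

(** The letters of a nonempty admissible word form an independent set. *)
Lemma Ncond_word w : w <> [] -> inW N adj w = true -> muS N mu (letters w) < muN w.
Proof.
  intros Hne HW. rewrite <- muS_nbhd. apply (Hcond (letters w)). apply inW_spec in HW as [HV HA].
  split; [|split].
  - destruct w as [|x w]; [contradiction|]. exists x.
    split; [apply HV|apply letters_spec]; now left.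
  - intros v Hv. now apply HV, letters_spec.
  - intros u v Hu Hv. apply letters_spec in Hu, Hv. auto.
Qed.

Lemma snoc_equiv (pre : list nat) u : In u pre -> forall x, In x (pre ++ [u]) <-> In x pre.
Proof. intros Hu x. rewrite in_app_iff. simpl. split; [intros [|[<-|[]]]|]; auto. Qed.

(* Induction on the letters not yet in [pre]: a repeated letter does not change the set of
   letters of [pre], and the total weight of the repeated letters is [< 1] by [Ncond]. *)
Lemma tail_sum_bounded rest : forall pre,
  (forall v, inV N v -> In v pre \/ In v rest) ->
  exists B, forall n, tail_sum n pre <= B.
Proof.
  induction rest as [rest IH] using (induction_ltof1 _ (@length nat)); unfold ltof in IH.
  intros pre Hcover.
  destruct (inW N adj pre) eqn:HW;
    [|exists 0; intros n; rewrite tail_sum_out by exact HW; lra].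
  (* Uniform bound on the contribution of each new letter, from the induction hypothesis: appending
     [u] to the prefix allows it to be removed from [rest]. *)
  destruct (common_bound (vert N) (fun u n => if letters pre u then 0 else
      mu u / muN (pre ++ [u]) * tail_sum n (pre ++ [u]))) as (C & HC & HCu).
  { intros u Hu. apply in_vert in Hu. destruct (letters pre u) eqn:Hl; [exists 0; intros; lra|].
    assert (Hr : In u rest).
    { destruct (Hcover u Hu) as [Hp|]; auto. apply letters_spec in Hp. congruence. }
    destruct (IH (remove Nat.eq_dec u rest)) with (pre := pre ++ [u]) as [B HB].
    - now apply remove_length_lt.
    - intros v Hv. rewrite in_app_iff. destruct (Nat.eq_dec v u) as [->|Hvu].
      + left; right; now left.
      + destruct (Hcover v Hv); [now left; left|]. right. now apply in_in_remove.
    - exists (mu u / muN (pre ++ [u]) * B). intros n. apply Rmult_le_compat_l; [|apply HB].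
      apply Rlt_le, Rdiv_lt_0_compat; [now apply mu_pos|].
      apply (muN_pos _ u); auto. apply in_elt. }
  (* The ratio of the geometric series formed by repeated letters; such a letter leaves the
     denominator equal to [muN pre]. *)
  set (rho := sumR (vert N) (fun u => if letters pre u then mu u / muN pre else 0)).
  set (K := 1 + sumR (vert N) (fun _ => C)).
  assert (HK : 1 <= K).
  { assert (0 <= sumR (vert N) (fun _ => C)) by now apply sumR_nonneg. unfold K; lra. }
  assert (Hrho : 0 <= rho < 1).
  { assert (Hrho : rho = / muN pre * muS N mu (letters pre)).
    { unfold rho, muS. rewrite <- sumR_scal. apply sumR_ext. intros u _.
      destruct (letters pre u); unfold Rdiv; ring. }
    destruct pre as [|x w] eqn:Ep.
    (* The empty prefix has no letter to repeat, so [Ncond] is not called upon there. *)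
    - replace rho with 0; [lra|]. symmetry. apply sumR_0. reflexivity.
    - rewrite <- Ep in *.
      assert (Hm : 0 < muN pre).
      { apply (muN_pos pre x); [rewrite Ep; now left|].
        apply inW_spec in HW as [HV _]. apply HV. rewrite Ep. now left. }
      assert (Hlt : muS N mu (letters pre) < muN pre)
        by (apply Ncond_word; [rewrite Ep; discriminate|exact HW]).
      assert (0 <= muS N mu (letters pre)).
      { apply sumR_nonneg. intros v Hv. apply mu_vert in Hv. destruct (letters pre v); lra. }
      rewrite Hrho, Rmult_comm. split.
      + apply Rle_mult_inv_pos; lra.
      + apply (Rmult_lt_reg_r (muN pre)); [lra|].
        rewrite Rmult_assoc, Rinv_l; lra. }
  exists (K / (1 - rho)).
  apply (affine_recursion_bound (fun n => tail_sum n pre)); auto; [lra|now rewrite tail_sum_0|].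
  intros n. rewrite tail_sum_S by exact HW. unfold K. rewrite Rplus_assoc.
  apply Rplus_le_compat_l. unfold rho. rewrite Rmult_comm, <- sumR_scal, <- sumR_plus.
  apply sumR_le. intros u Hu. specialize (HCu u n Hu).
  destruct (letters pre u) eqn:Hl; [|lra].
  apply letters_spec in Hl. pose proof (snoc_equiv pre u Hl) as Heq.
  rewrite (muN_equiv _ _ Heq), (tail_sum_equiv n _ _ Heq). lra.
Qed.

Lemma piU_summable : exists Z, 0 < Z /\ Un_cv (fun n => sumR (states n) (piU N adj mu)) Z.
Proof.
  destruct (tail_sum_bounded (vert N) []) as [B HB].
  { intros v Hv. right. now apply in_vert. }
  assert (Hs : forall n, sumR (states n) (piU N adj mu) = tail_sum n [])
    by (intros n; now rewrite <- sumW_partial_states).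
  assert (Hgr : Un_growing (fun n => sumR (states n) (piU N adj mu))).
  { intros n. apply sumR_states_le; [lia|]. intros w Hw. now apply Rlt_le, piU_pos. }
  destruct (growing_cv _ Hgr) as [Z HZ].
  { exists B. intros y [n ->]. rewrite Hs. apply HB. }
  exists Z. split; [|exact HZ].
  apply Rlt_le_trans with (sumR (states 0) (piU N adj mu)).
  - rewrite Hs, tail_sum_0 by reflexivity. lra.
  - apply (growing_ineq _ Z Hgr HZ 0).
Qed.

End Buffer.

(** * The recurrence criterion and the stationary law *)

(** By connectedness an isolated vertex would be the only one; the graph would have no edge and any
    colouring would be proper. This keeps the denominators of the product form positive. *)
Lemma connected_nonbipartite_degree N adj : simple_graph N adj -> connected N adj ->
  ~ bipartite N adj -> forall u, inV N u -> exists v, adj u v = true.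
Proof.
  intros (Hsym & _ & HV) Hconn Hnb u Hu. apply NNPP. intros Hno. apply Hnb.
  exists (fun _ => true). intros a b Hab _.
  destruct (Hconn u a Hu (proj1 (HV a b Hab))) as [[|z p] Hp]; simpl in Hp.
  - subst a. eauto.
  - apply Hno. exists z. tauto.
Qed.

Theorem theorem1 (N : nat) (adj : nat -> nat -> bool) (mu : nat -> R)
  (Hg : simple_graph N adj) (Hconn : connected N adj)
  (Hnb : ~ bipartite N adj) (Hmu : full_support_prob N mu) :
  (pos_recurrent N adj mu <-> Ncond N adj mu) /\
  (Ncond N adj mu ->
     exists alpha : R, 0 < alpha /\
       stationary N adj mu (fun w => alpha * piU N adj mu w) /\
       (forall pi : list nat -> R, stationary N adj mu pi ->
          forall w, inW N adj w = true -> pi w = alpha * piU N adj mu w)).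
Proof.
  pose proof (connected_nonbipartite_degree N adj Hg Hconn Hnb) as Hdeg.
  assert (Hst : Ncond N adj mu -> exists alpha, 0 < alpha /\
    stationary N adj mu (fun w => alpha * piU N adj mu w)).
  { intros Hc. destruct (piU_summable N adj Hg mu Hmu Hdeg Hc) as (Z & HZ & Hcv).
    exists (/ Z). split; [now apply Rinv_0_lt_compat|].
    apply stationary_balanced; auto. split; [|split].
    - intros w Hw. apply Rlt_le, Rmult_lt_0_compat; [now apply Rinv_0_lt_compat|].
      now apply piU_pos.
    - intros eps He. destruct (Hcv (Z * eps)) as [n0 Hn0]; [now apply Rmult_lt_0_compat|].
      exists n0. intros n Hn. specialize (Hn0 n Hn). unfold Rdist in *.
      rewrite sumR_scal. set (S := sumR _ _) in *.
      replace (/ Z * S - 1) with (/ Z * (S - Z)) by (field; lra).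
      rewrite Rabs_mult, (Rabs_pos_eq (/ Z)) by (apply Rlt_le, Rinv_0_lt_compat; lra).
      apply (Rmult_lt_reg_l Z); [exact HZ|].
      rewrite <- Rmult_assoc, Rinv_r, Rmult_1_l; lra.
    - intros n x Hx. rewrite <- (piU_balanced N adj Hg mu Hmu Hdeg n x Hx), <- sumR_scal.
      apply sumR_ext. intros; ring. }
  split; [split|].
  - intros Hrec. apply recurrent_Ncond; auto.
  - intros Hc w Hw. destruct (Hst Hc) as (alpha & Ha & Hs).
    apply (positive_stationary_recurrent N adj Hg mu Hmu _ w Hs Hw).
    apply Rmult_lt_0_compat; [exact Ha|]. now apply piU_pos.
  - intros Hc. destruct (Hst Hc) as (alpha & Ha & Hs). exists alpha. split; [exact Ha|].
    split; [exact Hs|]. intros p Hp.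
    pose proof Hs as Hs'. apply (stationary_balanced N adj Hg mu) in Hs' as (H1 & H2 & H3).
    apply (stationary_balanced N adj Hg mu) in Hp as (K1 & K2 & K3).
    assert (Hpos : forall w, inW N adj w = true -> 0 < alpha * piU N adj mu w).
    { intros w Hw. apply Rmult_lt_0_compat; [exact Ha|]. now apply piU_pos. }
    set (q := fun w => alpha * piU N adj mu w) in *.
    pose proof (stationary_ratio N adj Hg mu Hmu q p 1 K1 Hpos H3 K3 K2) as Hratio.
    set (c := p [] / q []) in Hratio.
    (* The two laws are proportional by [stationary_ratio], and both have total mass 1. *)
    assert (c = 1) as Hc1.
    { apply (UL_sequence (fun n => sumR (states N adj n) p)); [|exact K2].
      apply (Un_cv_ext (fun n => c * sumR (states N adj n) q)).
      - intros n. rewrite <- sumR_scal. apply sumR_ext. intros w Hw.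
        apply in_states in Hw as [Hw _]. symmetry. now apply Hratio.
      - rewrite <- (Rmult_1_r c) at 1. apply CV_mult; [|exact H2].
        intros eps He. exists O. intros n _. unfold Rdist. rewrite Rminus_diag, Rabs_R0. lra. }
    intros w Hw. rewrite (Hratio w Hw), Hc1. unfold q. ring.
Qed.
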